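(* Let $\Omega\subset\mathbb{R}^2$ be open, $\lambda>0$, and let $u\in L^2(\Omega)$ satisfy $-\Delta u=\lambda u$ in $\Omega$. Let $\mathbf{x}_0\in\Omega$, $h>0$, and let $\mathbf{e}^-,\mathbf{e}^+$ be unit vectors with angle $\alpha\pi$ from $\mathbf{e}^-$ to $\mathbf{e}^+$, where $\alpha\in(0,2)$ is irrational; put $\Gamma^\pm=\{\mathbf{x}_0+t\mathbf{e}^\pm:0\le t\le h\}\subset\Omega$. Suppose $\Gamma^+$ is a singular line of $u$ ($\partial_\nu u=0$ on $\Gamma^+$) and $\Gamma^-$ is a generalized singular line of $u$ with constant parameter $\eta_1\equiv C_1$. Then $\mathrm{Vani}(u;\mathbf{x}_0)=0$ if $u(\mathbf{x}_0)\neq0$, and $\mathrm{Vani}(u;\mathbf{x}_0)=+\infty$ if $u(\mathbf{x}_0)=0$.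
   Context: No boundary condition is imposed on $\partial\Omega$; $u$ is real-analytic in $\Omega$. $\nu$ denotes a unit normal to the segment in question. A generalized singular line with parameter $\eta$ (not identically zero; here a nonzero complex constant) is a segment on which $\partial_\nu u+\eta u=0$. $\mathrm{Vani}(u;\mathbf{x}_0)$ is the smallest degree of a nonzero homogeneous term in the Taylor expansion of $u$ at $\mathbf{x}_0$ ($+\infty$ if all vanish). *)

(* Defs.v *)
From HB Require Import structures.
From mathcomp Require Import all_boot all_order all_algebra.
From mathcomp Require Import all_classical all_reals all_analysis.
Set Implicit Arguments. Unset Strict Implicit. Unset Printing Implicit Defensive.
Import Order.TTheory GRing.Theory Num.Theory.
Import numFieldNormedType.Exports.
Local Open Scope classical_set_scope.
Local Open Scope ring_scope.

Section Defs.
Context {R : realType}.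

(* points of R^2 are pairs (x, y) : R * R; a complex-valued function u is
   represented by its real part ur and imaginary part ui : R * R -> R. *)

Definition pdx (f : R * R -> R) : R * R -> R :=
  fun p => derive1 (fun t => f (t, p.2)) p.1.
Definition pdy (f : R * R -> R) : R * R -> R :=
  fun p => derive1 (fun t => f (p.1, t)) p.2.

Definition pderiv (i j : nat) (f : R * R -> R) : R * R -> R :=
  iter i pdx (iter j pdy f).

Definition laplacian (f : R * R -> R) : R * R -> R :=
  fun p => pdx (pdx f) p + pdy (pdy f) p.

Definition normal_deriv (nu : R * R) (f : R * R -> R) : R * R -> R :=
  fun p => nu.1 * pdx f p + nu.2 * pdy f p.

(* real-analyticity at p: f equals an (absolutely convergent) double power
   series centered at p on a neighbourhood of p; the series is summed by
   total degree k = i + j. *)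
Definition real_analytic_at (f : R * R -> R) (p : R * R) : Prop :=
  exists (r : R) (a : nat -> nat -> R), 0 < r /\
    forall q : R * R, `|q.1 - p.1| < r -> `|q.2 - p.2| < r ->
      cvgn (series (fun k => \sum_(i < k.+1)
              `|a i (k - i)%N| * `|q.1 - p.1| ^+ i * `|q.2 - p.2| ^+ (k - i)))
      /\ f q = limn (series (fun k => \sum_(i < k.+1)
              a i (k - i)%N * (q.1 - p.1) ^+ i * (q.2 - p.2) ^+ (k - i))).

Definition real_analytic_on (O : set (R * R)) (f : R * R -> R) : Prop :=
  forall p, O p -> real_analytic_at f p.

Definition L2_on (O : set (R * R)) (ur ui : R * R -> R) : Prop :=
  measurable_fun (O : set (measurableTypeR R * measurableTypeR R)%type) ur /\
  measurable_fun (O : set (measurableTypeR R * measurableTypeR R)%type) ui /\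
  (\int[((@lebesgue_measure R) \x (@lebesgue_measure R))%E]_(z in O)
      ((ur z) ^+ 2 + (ui z) ^+ 2)%:E < +oo)%E.

Definition segment (x0 e : R * R) (h : R) : set (R * R) :=
  [set (x0.1 + t * e.1, x0.2 + t * e.2) | t in `[0, h]].

(* the homogeneous term of degree N of the Taylor expansion of u = ur + i ui
   at x0, i.e. sum_(i+j=N) d^i_x d^j_y u(x0) / (i! j!) (x-x0.1)^i (y-x0.2)^j,
   is a nonzero polynomial *)
Definition hom_term_nonzero (ur ui : R * R -> R) (x0 : R * R) (N : nat) : Prop :=
  exists i j : nat, (i + j)%N = N /\
    (pderiv i j ur x0 != 0 \/ pderiv i j ui x0 != 0).

Lemma hom_term_exists_bool (ur ui : R * R -> R) (x0 : R * R) :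
  (exists N, hom_term_nonzero ur ui x0 N) ->
  exists N, `[< hom_term_nonzero ur ui x0 N >].
Proof. by case=> N HN; exists N; apply/asboolP. Qed.

(* Vani(u; x0) : Some N = the smallest such degree N, None = +infinity *)
Definition Vani (ur ui : R * R -> R) (x0 : R * R) : option nat :=
  match pselect (exists N, hom_term_nonzero ur ui x0 N) with
  | left H => Some (ex_minn (hom_term_exists_bool H))
  | right _ => None
  end.

End Defs.

(* Main.v *)
(* Let [P_N] be the homogeneous Taylor term of degree [N] of [u] at [x0], and
   suppose the terms of lower degree vanish.  The equation makes [P_N]
   harmonic, so [(d_x - i d_y) P_N = c (x + i y)^(N - 1)].  In the condition on
   [Gamma^-] the term [C1 u] is of higher order than [d_nu u], so at leading
   order [d_nu P_N = 0] on both rays, for the real and imaginary parts of [u]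
   separately.  This says that [c e^N] is real for [e = e^-] and for
   [e = e^+ = e^- exp(i alpha pi)]; as [sin (N alpha pi) <> 0] for irrational
   [alpha], [c = 0] and [P_N = 0]. *)

Require Import Defs.
From HB Require Import structures.
From mathcomp Require Import all_boot all_order all_algebra.
From mathcomp Require Import all_classical all_reals all_analysis.
From mathcomp Require Import ring lra complex.
Import Order.TTheory GRing.Theory Num.Theory.
Import numFieldNormedType.Exports.
Local Open Scope classical_set_scope.
Local Open Scope ring_scope.

Set Implicit Arguments.
Unset Strict Implicit.

(** * Double power series *)

Lemma geometric_sum_le {R : realType} (q : R) (n : nat) :
  0 <= q -> q < 1 -> \sum_(i < n) q ^+ i <= (1 - q)^-1.
Proof.
move=> q0 q1; have q1' : 0 < 1 - q by lra.
rewrite -(ler_pM2r q1') mulVf ?gt_eqF//.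
have := subrX1 q n; have := exprn_ge0 n q0; set s := \sum_(i < n) _; nra.
Qed.

(** Each of the [n + 1] terms [q ^ i] with [i <= n] is at least [q ^ n], so the geometric sum
    dominates. *)
Lemma natr_exp_bounded {R : realType} (q : R) (n : nat) :
  0 <= q -> q < 1 -> n.+1%:R * q ^+ n <= (1 - q)^-1.
Proof.
move=> q0 q1; apply: le_trans (geometric_sum_le n.+1 q0 q1).
rewrite mulr_natl -[X in _ *+ X]card_ord -sumr_const; apply: ler_sum => i _.
by rewrite ler_wiXn2l ?(ltW q1)// -ltnS.
Qed.

(** Polynomial factors cost only a worse ratio. With [q = s ^ 2], one factor [n + 1] is absorbed by
    one copy of [s ^ n], and induction treats the others with the second copy. *)
Lemma natrX_exp_le_geometric {R : realType} (d : nat) (q : R) :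
  0 <= q -> q < 1 ->
  exists C q' : R, [/\ 0 <= C, 0 <= q', q' < 1 &
    forall n, n.+1%:R ^+ d * q ^+ n <= C * q' ^+ n].
Proof.
elim: d q => [|d IH] q q0 q1.
  by exists 1, q; split=> // n; rewrite expr0.
pose s := Num.sqrt q.
have s0 : 0 <= s by exact: sqrtr_ge0.
have sE : s ^+ 2 = q by rewrite sqr_sqrtr.
have s1 : s < 1 by rewrite -sqrtr1 ltr_sqrt.
have [C [q' [C0 q'0 q'1 H]]] := IH s s0 s1.
have s1' : 0 <= (1 - s)^-1 by rewrite invr_ge0; lra.
exists ((1 - s)^-1 * C), q'; split; rewrite ?mulr_ge0// => n.
rewrite -sE -exprM mul2n -addnn exprD exprS mulrACA.
rewrite -[leRHS]mulrA; apply: ler_pM; rewrite ?natr_exp_bounded//.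
  by rewrite mulr_ge0 ?exprn_ge0.
by rewrite mulr_ge0 ?exprn_ge0.
Qed.

Lemma series_geometric_le {R : realType} (u : nat -> R) (C q : R) (n : nat) :
  0 <= C -> 0 <= q -> q < 1 -> (forall k, `|u k| <= C * q ^+ k) ->
  `|series u n| <= C * (1 - q)^-1.
Proof.
move=> C0 q0 q1 H; rewrite /series/= big_mkord.
apply: le_trans (ler_norm_sum _ _ _) _.
apply: (@le_trans _ _ (C * \sum_(i < n) q ^+ i)).
  by rewrite mulr_sumr; apply: ler_sum => i _.
by rewrite ler_wpM2l// geometric_sum_le.
Qed.

Lemma cvg_series_geometric_le {R : realType} (u : nat -> R) (C q : R) :
  0 <= q -> q < 1 -> (forall k, `|u k| <= C * q ^+ k) -> cvgn (series u).
Proof.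
move=> q0 q1 H; apply: normed_cvg.
have C0 : 0 <= C by have := H 0; rewrite expr0 mulr1; exact: le_trans.
apply: (@series_le_cvg _ _ (geometric C q)) => //=.
- by move=> n; exact: geometric_ge0.
- by apply: is_cvg_geometric_series; rewrite ger0_norm.
Qed.

Lemma cvgn_norm_le {R : realType} (u : nat -> R) (l C : R) :
  u @ \oo --> l -> (forall n, `|u n| <= C) -> `|l| <= C.
Proof.
move=> ul H; have nl : (fun n => `|u n|) @ \oo --> `|l| by exact: cvg_norm.
rewrite -(cvg_lim _ nl)//; apply: limr_le; first by apply/cvg_ex; exists `|l|.
by apply: nearW => n; exact: H.
Qed.

Definition hom_part {R : realType} (a : nat -> nat -> R) (k : nat) (x y : R) : R :=
  \sum_(i < k.+1) a i (k - i)%N * x ^+ i * y ^+ (k - i).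

(* The coefficient bound gives absolute convergence on the open square of
   half-side [rho], and it survives differentiation at the price of a smaller
   [rho]. *)
Definition expands {R : realType} (f : R * R -> R) (p : R * R) (rho : R)
    (a : nat -> nat -> R) : Prop :=
  [/\ 0 < rho,
      exists M, forall i j, `|a i j| * rho ^+ (i + j) <= M &
      forall q : R * R, `|q.1 - p.1| < rho -> `|q.2 - p.2| < rho ->
        f q = limn (series (fun k => hom_part a k (q.1 - p.1) (q.2 - p.2)))].

Lemma hom_part_le {R : realType} (a : nat -> nat -> R) (rho M m x y : R) (k : nat) :
  0 < rho -> (forall i j, `|a i j| * rho ^+ (i + j) <= M) ->
  `|x| <= m -> `|y| <= m -> `|hom_part a k x y| <= k.+1%:R * (M * (m / rho) ^+ k).
Proof.
move=> r0 HM xm ym; have m0 : 0 <= m by exact: le_trans xm.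
apply: le_trans (ler_norm_sum _ _ _) _.
rewrite mulr_natl -[X in _ *+ X]card_ord -sumr_const.
apply: ler_sum => -[i ik] _ /=.
have {}ik : (i <= k)%N by rewrite -ltnS.
rewrite !normrM !normrX.
apply: (@le_trans _ _ (`|a i (k - i)%N| * m ^+ k)).
  have -> : m ^+ k = m ^+ i * m ^+ (k - i) by rewrite -exprD subnKC.
  rewrite -mulrA ler_wpM2l//.
  by apply: ler_pM; rewrite ?exprn_ge0// lerXn2r ?nnegrE.
have -> : m ^+ k = rho ^+ k * (m / rho) ^+ k.
  by rewrite -exprMn mulrCA mulfV ?mulr1// gt_eqF.
rewrite mulrA ler_wpM2r ?exprn_ge0 ?divr_ge0 ?(ltW r0)//.
by have := HM i (k - i)%N; rewrite subnKC.
Qed.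

Lemma cvg_series_hom_part {R : realType} (a : nat -> nat -> R) (rho M x y : R) :
  0 < rho -> (forall i j, `|a i j| * rho ^+ (i + j) <= M) ->
  `|x| < rho -> `|y| < rho -> cvgn (series (fun k => hom_part a k x y)).
Proof.
move=> r0 HM xr yr; pose m := Num.max `|x| `|y|.
have m0 : 0 <= m by rewrite le_max normr_ge0.
have q0 : 0 <= m / rho by rewrite divr_ge0// ltW.
have q1 : m / rho < 1 by rewrite ltr_pdivrMr// mul1r gt_max xr.
have [C [q' [C0 q'0 q'1 H]]] := natrX_exp_le_geometric 1 q0 q1.
have M0 : 0 <= M.
  by apply: le_trans (HM 0 0); rewrite mulr_ge0 ?exprn_ge0// ltW.
apply: (@cvg_series_geometric_le _ _ (M * C) q') => // k.
apply: le_trans (@hom_part_le _ _ _ _ m _ _ k r0 HM _ _) _.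
- by rewrite /m le_max lexx.
- by rewrite /m le_max lexx orbT.
by rewrite mulrCA -mulrA ler_wpM2l// -[k.+1%:R]expr1.
Qed.

Lemma expands_cvg {R : realType} (f : R * R -> R) p rho a (q : R * R) :
  expands f p rho a -> `|q.1 - p.1| < rho -> `|q.2 - p.2| < rho ->
  series (fun k => hom_part a k (q.1 - p.1) (q.2 - p.2)) @ \oo --> f q.
Proof.
move=> [r0 [M HM] H] q1 q2; rewrite H//.
exact: (cvg_series_hom_part r0 HM).
Qed.

(** Absolute convergence at the single point [p + (r / 2, r / 2)] bounds the terms of the series
    there, which gives the coefficient bound at radius [r / 2]. *)
Lemma real_analytic_expands {R : realType} (f : R * R -> R) (p : R * R) :
  real_analytic_at f p -> exists rho a, expands f p rho a.
Proof.
move=> [r [a [r0 H]]]; exists (r / 2), a; have r20 : 0 < r / 2 by lra.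
split=> //; last first.
  move=> q q1 q2; have [||_ ->//] := H q.
    by apply: lt_trans q1 _; lra.
  by apply: lt_trans q2 _; lra.
have ap : `|r / 2| < r by rewrite ger0_norm; lra.
have [||cv _] := H (p.1 + r / 2, p.2 + r / 2) => /=.
- by rewrite addrC addKr.
- by rewrite addrC addKr.
have /= [M [_ /(_ (M + 1))]] := cvg_series_bounded cv.
rewrite ltrDl ltr01 => /(_ isT) HM.
exists (M + 1) => i j; apply: le_trans (HM (i + j)%N I).
apply: le_trans (ler_norm _).
have ij : (i < (i + j).+1)%N by rewrite ltnS leq_addr.
(* The monomial of index [(i, j)] is one of the nonnegative summands of total degree [i + j]. *)
rewrite (bigD1 (Ordinal ij))//= -[leLHS]addr0 lerD//.
  rewrite addKn ![p.1 + _]addrC ![p.2 + _]addrC !addrK.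
  rewrite (@ger0_norm _ (r / 2)) ?(ltW r20)//.
  by rewrite exprD mulrA.
by apply: sumr_ge0 => k _; rewrite !mulr_ge0 ?exprn_ge0.
Qed.

(** * Termwise differentiation *)

(** Second-order Taylor remainder of a power. The factor [m ^ 2] stands on the left so that neither
    an exponent [i - 2] nor a division by [m] occurs. *)
Lemma expr_taylor2_le {R : realType} (x s m : R) (i : nat) :
  `|x| <= m -> `|x + s| <= m ->
  `|(x + s) ^+ i - x ^+ i - s * (i%:R * x ^+ i.-1)| * m ^+ 2
    <= s ^+ 2 * (i%:R ^+ 2 * m ^+ i).
Proof.
move=> xm xsm; have m0 : 0 <= m by exact: le_trans xm.
elim: i => [|i IH].
  by rewrite !expr0 mul0r mulr0 subr0 subrr normr0 !mul0r expr0n/= mul0r mulr0.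
set E := _ - _ in IH.
(* Recursion for the remainders: the next one is [(x + s)] times the current one plus
   [i x ^ (i - 1) s ^ 2]. *)
have -> : (x + s) ^+ i.+1 - x ^+ i.+1 - s * (i.+1%:R * x ^+ i.+1.-1)
    = (x + s) * E + i%:R * x ^+ i.-1 * s ^+ 2.
  rewrite /E /=; case: i {IH E} => [|i] /=; first by rewrite !expr0 expr1; ring.
  by rewrite -[i.+2%:R]natr1 !exprS; ring.
apply: (@le_trans _ _ ((m * `|E| + i%:R * m ^+ i.-1 * s ^+ 2) * m ^+ 2)).
  rewrite ler_wpM2r ?exprn_ge0//; apply: le_trans (ler_normD _ _) _.
  have nE : `|i%:R * x ^+ i.-1 * s ^+ 2| = i%:R * `|x| ^+ i.-1 * s ^+ 2.
    by rewrite !normrM -expr2 real_normK ?num_real// normr_nat normrX.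
  rewrite nE normrM; apply: lerD; first by rewrite ler_wpM2r.
  by rewrite ler_wpM2r ?sqr_ge0// ler_wpM2l// lerXn2r.
have -> : (m * `|E| + i%:R * m ^+ i.-1 * s ^+ 2) * m ^+ 2
    = m * (`|E| * m ^+ 2) + s ^+ 2 * (i%:R * m ^+ i.+1).
  by case: (i) => [|j] /=; rewrite ?exprS; ring.
apply: (@le_trans _ _
    (m * (s ^+ 2 * (i%:R ^+ 2 * m ^+ i)) + s ^+ 2 * (i%:R * m ^+ i.+1))).
  by rewrite lerD2r ler_wpM2l.
rewrite -subr_ge0.
have -> : s ^+ 2 * (i.+1%:R ^+ 2 * m ^+ i.+1)
    - (m * (s ^+ 2 * (i%:R ^+ 2 * m ^+ i)) + s ^+ 2 * (i%:R * m ^+ i.+1))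
    = s ^+ 2 * (i.+1%:R * m ^+ i.+1).
  by rewrite -natr1 [m ^+ i.+1]exprS; ring.
by rewrite mulr_ge0 ?sqr_ge0// mulr_ge0 ?exprn_ge0.
Qed.

Lemma derive1_quadratic_remainder {R : realType} (phi : R -> R) (x g C d : R) :
  0 < d -> 0 <= C ->
  (forall s, `|s| < d -> `|phi (x + s) - phi x - s * g| <= C * s ^+ 2) ->
  derive1 phi x = g.
Proof.
move=> d0 C0 H; rewrite /derive1; apply: cvg_lim => //.
apply/cvgrPdist_le => e e0.
have C1 : 0 < C + 1 by lra.
(* The difference quotient is off by at most [C |s|]; dividing by [C + 1] keeps the threshold
   meaningful when [C = 0]. *)
have de : 0 < Num.min d (e / (C + 1)) by rewrite lt_min d0 divr_gt0.
near=> s.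
have s0 : s != 0 by near: s; exact: nbhs_dnbhs_neq.
have : `|s| < Num.min d (e / (C + 1)).
  near: s; apply: dnbhs0_lt; exact: de.
rewrite lt_min ltr_pdivlMr// => /andP[sd se].
have sp : 0 < `|s| by rewrite normr_gt0.
have -> : g - s^-1 *: (phi (s + x) - phi x)
    = - (s^-1 * (phi (x + s) - phi x - s * g)).
  by rewrite [s + x]addrC /GRing.scale/=; field.
rewrite normrN normrM normfV mulrC ler_pdivrMr//.
apply: le_trans (H s sd) _.
rewrite -(@real_normK _ s) ?num_real//.
by nra.
Unshelve. all: by end_near. Qed.

(** Formal [x]-derivative of [hom_part]; at [i = 0] the truncated exponent [i.-1] is harmless
    because of the factor [i]. *)
Definition dhom_part {R : realType} (a : nat -> nat -> R) (k : nat) (x y : R) : R :=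
  \sum_(i < k.+1) a i (k - i)%N * (i%:R * x ^+ i.-1) * y ^+ (k - i).

Lemma dhom_part0 {R : realType} (a : nat -> nat -> R) (x y : R) :
  dhom_part a 0 x y = 0.
Proof. by rewrite /dhom_part big_ord1 mul0r mulr0 mul0r. Qed.

Lemma dhom_partS {R : realType} (a : nat -> nat -> R) (k : nat) (x y : R) :
  dhom_part a k.+1 x y = hom_part (fun i j => i.+1%:R * a i.+1 j) k x y.
Proof.
rewrite /dhom_part big_ord_recl /= mul0r mulr0 mul0r add0r.
apply: eq_bigr => i _; rewrite /bump /= add1n subSS /=; ring.
Qed.

(** The cube comes from [i ^ 2 <= (k + 1) ^ 2] in each monomial and from the [k + 1] monomials. *)
Lemma hom_part_taylor2_le {R : realType} (a : nat -> nat -> R)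
    (rho M m x y s : R) (k : nat) :
  0 < rho -> (forall i j, `|a i j| * rho ^+ (i + j) <= M) ->
  `|x| <= m -> `|x + s| <= m -> `|y| <= m ->
  `|hom_part a k (x + s) y - hom_part a k x y - s * dhom_part a k x y| * m ^+ 2
    <= s ^+ 2 * (M * (k.+1%:R ^+ 3 * (m / rho) ^+ k)).
Proof.
move=> r0 HM xm xsm ym; have m0 : 0 <= m by exact: le_trans xm.
rewrite /hom_part /dhom_part mulr_sumr -!sumrB.
apply: (@le_trans _ _
    (\sum_(i < k.+1) s ^+ 2 * (M * (k.+1%:R ^+ 2 * (m / rho) ^+ k)))); last first.
  rewrite sumr_const card_ord -mulr_natl.
  rewrite -subr_ge0 (_ : _ - _ = 0)//; ring.
apply: le_trans (ler_wpM2r (sqr_ge0 _) (ler_norm_sum _ _ _)) _.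
rewrite mulr_suml; apply: ler_sum => -[i ik] _ /=.
have {}ik : (i <= k)%N by rewrite -ltnS.
have -> : a i (k - i)%N * (x + s) ^+ i * y ^+ (k - i)
   - a i (k - i)%N * x ^+ i * y ^+ (k - i)
   - s * (a i (k - i)%N * (i%:R * x ^+ i.-1) * y ^+ (k - i))
   = (a i (k - i)%N * y ^+ (k - i)) *
     ((x + s) ^+ i - x ^+ i - s * (i%:R * x ^+ i.-1)) by ring.
rewrite normrM -mulrA.
apply: (@le_trans _ _
    ((`|a i (k - i)%N| * m ^+ (k - i)) * (s ^+ 2 * (i%:R ^+ 2 * m ^+ i)))).
  apply: ler_pM; rewrite ?normr_ge0 ?mulr_ge0 ?sqr_ge0//.
    by rewrite normrM normrX ler_wpM2l// lerXn2r// nnegrE.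
  exact: expr_taylor2_le.
have -> : `|a i (k - i)%N| * m ^+ (k - i) * (s ^+ 2 * (i%:R ^+ 2 * m ^+ i))
   = s ^+ 2 * (i%:R ^+ 2 * (`|a i (k - i)%N| * (m ^+ i * m ^+ (k - i)))) by ring.
rewrite -exprD subnKC// ler_wpM2l ?sqr_ge0//.
have -> : m ^+ k = rho ^+ k * (m / rho) ^+ k.
  by rewrite -exprMn mulrCA mulfV ?mulr1// gt_eqF.
rewrite [in leRHS]mulrCA; apply: ler_pM; rewrite ?sqr_ge0//.
- by rewrite !mulr_ge0 ?exprn_ge0 ?divr_ge0// ltW.
- by rewrite lerXn2r ?nnegrE// ler_nat leqW.
rewrite mulrA ler_wpM2r ?exprn_ge0 ?divr_ge0 ?(ltW r0)//.
by have := HM i (k - i)%N; rewrite subnKC.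
Qed.

(** The factor [i + 1] is absorbed by [(sigma / rho) ^ (i + j)]. Summing the remainders of the
    homogeneous parts gives a quadratic remainder for [f], which identifies its derivative with the
    differentiated series. *)
Lemma expands_pdx {R : realType} (f : R * R -> R) p rho a sigma :
  expands f p rho a -> 0 < sigma -> sigma < rho ->
  expands (pdx f) p sigma (fun i j => i.+1%:R * a i.+1 j).
Proof.
move=> exf s0 sr; have [r0 [M HM] _] := exf.
have sr1 : sigma / rho < 1 by rewrite ltr_pdivrMr// mul1r.
have sr0 : 0 <= sigma / rho by rewrite divr_ge0// ltW.
have M0 : 0 <= M.
  by apply: le_trans (HM 0 0); rewrite mulr_ge0 ?exprn_ge0// ltW.
have HM' : forall i j,
    `|i.+1%:R * a i.+1 j| * sigma ^+ (i + j) <= M / rho * (1 - sigma / rho)^-1.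
  move=> i j; rewrite normrM normr_nat.
  have -> : sigma ^+ (i + j) = rho ^+ (i + j) * (sigma / rho) ^+ (i + j).
    by rewrite -exprMn mulrCA mulfV ?mulr1// gt_eqF.
  have -> : i.+1%:R * `|a i.+1 j| * (rho ^+ (i + j) * (sigma / rho) ^+ (i + j))
    = (`|a i.+1 j| * rho ^+ (i + j)) * (i.+1%:R * (sigma / rho) ^+ (i + j)).
    by ring.
  apply: ler_pM.
  - by rewrite mulr_ge0// exprn_ge0// ltW.
  - by rewrite mulr_ge0// exprn_ge0.
  - rewrite ler_pdivlMr// -mulrA -exprSr; exact: HM i.+1 j.
  apply: le_trans (natr_exp_bounded (i + j) sr0 sr1).
  by rewrite ler_wpM2r ?exprn_ge0// ler_nat ltnS leq_addr.
split=> //; first by eexists; exact: HM'.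
move=> q q1 q2; rewrite /pdx.
set x := q.1 - p.1; set y := q.2 - p.2.
set g := limn _.
have gT : series (fun k => dhom_part a k x y) @ \oo --> g.
  (* The degree 0 part has derivative zero, so the differentiated series is shifted by one
     degree. *)
  rewrite -(cvg_shiftS _).
  have -> : (fun n => series (fun k => dhom_part a k x y) n.+1)
      = series (fun k => hom_part (fun i j => i.+1%:R * a i.+1 j) k x y).
    apply/funext => n; rewrite /series/= big_nat_recl//= dhom_part0 add0r.
    by apply: eq_bigr => i _; rewrite dhom_partS.
  exact: (cvg_series_hom_part s0 HM').
(* A radius strictly between the point and [sigma] leaves room for an increment of size less than
   [m - |x|]. *)
pose m := (Num.max `|x| `|y| + sigma) / 2.
have mx : Num.max `|x| `|y| < sigma by rewrite gt_max q1.
have xm : `|x| < m.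
  apply: (@le_lt_trans _ _ (Num.max `|x| `|y|)); first by rewrite le_max lexx.
  rewrite /m; lra.
have ym : `|y| < m.
  apply: (@le_lt_trans _ _ (Num.max `|x| `|y|)); first by rewrite le_max lexx orbT.
  rewrite /m; lra.
have m0 : 0 < m by exact: le_lt_trans xm.
have msigma : m < sigma by rewrite /m; lra.
have mr0 : 0 <= m / rho by rewrite divr_ge0// ltW.
have mr1 : m / rho < 1 by rewrite ltr_pdivrMr// mul1r; lra.
have [C [q' [C0 q'0 q'1 H]]] := natrX_exp_le_geometric 3 mr0 mr1.
have q'1' : 0 <= (1 - q')^-1 by rewrite invr_ge0; lra.
apply: (@derive1_quadratic_remainder _ _ _ _ (M * C / m ^+ 2 * (1 - q')^-1) (m - `|x|)).
- by lra.
- by rewrite !mulr_ge0// invr_ge0 sqr_ge0.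
move=> s sm.
have xsm : `|x + s| < m by apply: le_lt_trans (ler_normD _ _) _; lra.
have c1 : series (fun k => hom_part a k x y) @ \oo --> f (q.1, q.2).
  have := @expands_cvg _ _ _ _ _ (q.1, q.2) exf; apply => /=; rewrite -/x -/y; lra.
have c2 : series (fun k => hom_part a k (x + s) y) @ \oo --> f (q.1 + s, q.2).
  have := @expands_cvg _ _ _ _ _ (q.1 + s, q.2) exf; rewrite /= addrAC -/x -/y.
  by apply; lra.
pose T k := hom_part a k (x + s) y - hom_part a k x y - s * dhom_part a k x y.
have c3 : series T @ \oo --> f (q.1 + s, q.2) - f (q.1, q.2) - s * g.
  have -> : series T = (fun n => series (fun k => hom_part a k (x + s) y) n
      - series (fun k => hom_part a k x y) n
      - s * series (fun k => dhom_part a k x y) n).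
    by apply/funext => n; rewrite /series/= /T !sumrB mulr_sumr.
  apply: cvgB; first exact: cvgB.
  by apply: cvgM gT; exact: cvg_cst.
apply: (cvgn_norm_le c3) => n.
have -> : M * C / m ^+ 2 / (1 - q') * s ^+ 2
  = (s ^+ 2 * (M * C) / m ^+ 2) * (1 - q')^-1 by ring.
have C'0 : 0 <= s ^+ 2 * (M * C) / m ^+ 2.
  by rewrite divr_ge0 ?sqr_ge0// mulr_ge0 ?sqr_ge0// mulr_ge0.
apply: series_geometric_le => // k.
rewrite mulrAC ler_pdivlMr ?exprn_gt0//.
apply: le_trans (hom_part_taylor2_le k r0 HM (ltW xm) (ltW xsm) (ltW ym)) _.
have -> : s ^+ 2 * (M * C) * q' ^+ k = s ^+ 2 * (M * (C * q' ^+ k)) by ring.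
by apply: ler_wpM2l; rewrite ?sqr_ge0//; apply: ler_wpM2l.
Qed.

(** * Symmetry, restriction and linear combination of expansions *)

Lemma hom_part_swap {R : realType} (a : nat -> nat -> R) k x y :
  hom_part (fun i j => a j i) k x y = hom_part a k y x.
Proof.
rewrite /hom_part (reindex_inj rev_ord_inj)/=; apply: eq_bigr => -[i ik] _ /=.
by rewrite !subSS subKn// mulrAC.
Qed.

Lemma expands_swap {R : realType} (f : R * R -> R) p rho a :
  expands f p rho a ->
  expands (fun q => f (q.2, q.1)) (p.2, p.1) rho (fun i j => a j i).
Proof.
move=> [r0 [M HM] H]; split=> //; first by exists M => i j; rewrite addnC.
move=> q q1 q2; rewrite H//=; congr (limn (series _)).
by apply/funext => k; rewrite hom_part_swap.
Qed.

(** Exchanging the coordinates reduces this to the derivative in [x]. *)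
Lemma expands_pdy {R : realType} (f : R * R -> R) p rho a sigma :
  expands f p rho a -> 0 < sigma -> sigma < rho ->
  expands (pdy f) p sigma (fun i j => j.+1%:R * a i j.+1).
Proof.
move=> exf s0 sr; have := expands_swap (expands_pdx (expands_swap exf) s0 sr).
by case: p exf.
Qed.

Lemma expandsW {R : realType} (f : R * R -> R) p rho a sigma :
  expands f p rho a -> 0 < sigma -> sigma <= rho -> expands f p sigma a.
Proof.
move=> [r0 [M HM] H] s0 sr; split=> //.
  exists M => i j; apply: le_trans (HM i j); rewrite ler_wpM2l//.
  by rewrite lerXn2r// nnegrE ltW.
by move=> q q1 q2; apply: H; apply: lt_le_trans sr.
Qed.

Lemma hom_part_lin {R : realType} (a b : nat -> nat -> R) (c d x y : R) k :
  hom_part (fun i j => c * a i j + d * b i j) k x y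
    = c * hom_part a k x y + d * hom_part b k x y.
Proof.
rewrite /hom_part !mulr_sumr -big_split/=.
by apply: eq_bigr => i _; ring.
Qed.

Lemma expands_lin {R : realType} (f g : R * R -> R) p rho a b (c d : R) :
  expands f p rho a -> expands g p rho b ->
  expands (fun q => c * f q + d * g q) p rho (fun i j => c * a i j + d * b i j).
Proof.
move=> exf exg; have [r0 [M HM] _] := exf; have [_ [N HN] _] := exg.
split=> //.
  exists (`|c| * M + `|d| * N) => i j.
  apply: (@le_trans _ _ ((`|c| * `|a i j| + `|d| * `|b i j|) * rho ^+ (i + j))).
    rewrite ler_wpM2r ?exprn_ge0 ?(ltW r0)// -!normrM; exact: ler_normD.
  by rewrite mulrDl -!mulrA lerD// ler_wpM2l.
move=> q q1 q2; apply/esym/cvg_lim => //.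
have -> : series (fun k => hom_part (fun i j => c * a i j + d * b i j) k
      (q.1 - p.1) (q.2 - p.2))
    = (fun n => c * series (fun k => hom_part a k (q.1 - p.1) (q.2 - p.2)) n
       + d * series (fun k => hom_part b k (q.1 - p.1) (q.2 - p.2)) n).
  apply/funext => n; rewrite /series/= !mulr_sumr -big_split/=.
  by apply: eq_bigr => k _; exact: hom_part_lin.
apply: cvgD; apply: cvgM; try exact: cvg_cst.
  exact: expands_cvg exf q1 q2.
exact: expands_cvg exg q1 q2.
Qed.

(** * Uniqueness of the coefficients *)

Lemma expands_center {R : realType} (f : R * R -> R) p rho a :
  expands f p rho a -> f p = a 0%N 0%N.
Proof.
move=> [r0 _ H]; rewrite H ?subrr ?normr0//.
apply: cvg_lim => //; rewrite -(cvg_shiftS _).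
rewrite (_ : (fun n => _) = fun=> a 0%N 0%N); first exact: cvg_cst.
apply/funext => n; rewrite /series/= big_nat_recl//= big1_seq.
  by rewrite /hom_part big_ord1 !expr0 !mulr1 addr0.
move=> k _; rewrite /hom_part big1// => i _.
(* In positive degree one of the two exponents is positive, so the monomial vanishes at the
   origin. *)
case: (i : nat) => [|j]; last by rewrite exprS mul0r mulr0 mul0r.
by rewrite subn0 [X in _ * X]exprS mul0r mulr0.
Qed.

Lemma pdx_eq0 {R : realType} (f : R * R -> R) (p : R * R) (d : R) :
  (forall q : R * R, `|q.1 - p.1| < d -> `|q.2 - p.2| < d -> f q = 0) ->
  forall q : R * R, `|q.1 - p.1| < d -> `|q.2 - p.2| < d -> pdx f q = 0.
Proof.
move=> H q q1 q2; rewrite /pdx.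
apply: (@derive1_quadratic_remainder _ _ _ _ 0 (d - `|q.1 - p.1|)) => //.
  by rewrite subr_gt0.
move=> s sd; rewrite !H//= ?mulr0 ?subr0 ?normr0 ?mul0r//.
rewrite addrAC; apply: le_lt_trans (ler_normD _ _) _; lra.
Qed.

Lemma pdy_eq0 {R : realType} (f : R * R -> R) (p : R * R) (d : R) :
  (forall q : R * R, `|q.1 - p.1| < d -> `|q.2 - p.2| < d -> f q = 0) ->
  forall q : R * R, `|q.1 - p.1| < d -> `|q.2 - p.2| < d -> pdy f q = 0.
Proof.
move=> H [q1 q2] h1 h2.
apply: (@pdx_eq0 _ (fun q => f (q.2, q.1)) (p.2, p.1) d _ (q2, q1)) => //=.
by move=> q' h3 h4; apply: H.
Qed.

(** Differentiation brings each coefficient, up to a nonzero integer factor, to the constant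
    position. The radius of the expansion is halved each time, while [d] stays fixed. *)
Lemma expands0_eq0 {R : realType} (f : R * R -> R) (p : R * R) rho a (d : R) :
  expands f p rho a -> 0 < d ->
  (forall q : R * R, `|q.1 - p.1| < d -> `|q.2 - p.2| < d -> f q = 0) ->
  forall i j, a i j = 0.
Proof.
move=> exf d0 H i j; have [r0 _ _] := exf.
have h0 : 0 < rho / 2 by lra. have h1 : rho / 2 < rho by lra.
elim: i j f rho a exf H r0 h0 h1 => [|i IH] j f rho a exf H r0 h0 h1.
  elim: j f rho a exf H r0 h0 h1 => [|j IH] f rho a exf H r0 h0 h1.
    by rewrite -(expands_center exf) H ?subrr ?normr0.
  have /= := IH _ _ _ (expands_pdy exf h0 h1) (pdy_eq0 H) h0.
  move=> /(_ ltac:(lra) ltac:(lra)) /eqP.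
  by rewrite mulf_eq0 pnatr_eq0 => /eqP.
have /= := IH j _ _ _ (expands_pdx exf h0 h1) (pdx_eq0 H) h0.
move=> /(_ ltac:(lra) ltac:(lra)) /eqP.
by rewrite mulf_eq0 pnatr_eq0 => /eqP.
Qed.

(** Zero coefficients make [f] vanish on a whole square, hence also its derivatives; no formula
    relating mixed derivatives to coefficients has to be proved. *)
Lemma pderiv_eq0 {R : realType} (f : R * R -> R) (p : R * R) rho a i j :
  expands f p rho a -> (forall i j, a i j = 0) -> pderiv i j f p = 0.
Proof.
move=> exf a0.
have H0 : forall q : R * R, `|q.1 - p.1| < rho -> `|q.2 - p.2| < rho -> f q = 0.
  move=> q q1 q2; rewrite -(cvg_lim _ (expands_cvg exf q1 q2))//.
  rewrite (_ : series _ = fun=> 0) ?lim_cst//; apply/funext => n.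
  rewrite /series/= big1// => k _; rewrite /hom_part big1// => l _.
  by rewrite a0 !mul0r.
have [r0 _ _] := exf.
suff : forall q : R * R, `|q.1 - p.1| < rho -> `|q.2 - p.2| < rho ->
  pderiv i j f q = 0 by apply; rewrite subrr normr0.
rewrite /pderiv; elim: i => [|i IH] /=; last exact: pdx_eq0.
by elim: j => [|j IH] //=; exact: pdy_eq0.
Qed.

(** * Power series vanishing on a ray *)

Lemma power_series_shift {R : realType} (b : nat -> R) (t : R) :
  0 < t -> series (fun k => b k * t ^+ k) @ \oo --> (0 : R) ->
  series (fun k => b k.+1 * t ^+ k) @ \oo --> - (b 0%N / t).
Proof.
move=> t0 H.
have -> : series (fun k => b k.+1 * t ^+ k)
    = (fun n => t^-1 * (series (fun k => b k * t ^+ k) n.+1 - b 0%N)).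
  apply/funext => n; rewrite /series/= big_nat_recl// expr0 mulr1 addrAC subrr add0r.
  rewrite mulr_sumr; apply: eq_bigr => i _; rewrite exprS.
  by field; rewrite gt_eqF.
rewrite -(cvg_shiftS _) in H.
have -> : - (b 0%N / t) = t^-1 * (0 - b 0%N) by rewrite sub0r mulrN mulrC.
by apply: cvgM; [exact: cvg_cst|apply: cvgB => //; exact: cvg_cst].
Qed.

(** For small [t > 0], [b 0] is [-t] times the shifted series, whose sum is bounded by [L]; now [t]
    tends to 0. Only positive [t] are available because a ray is one-sided. *)
Lemma power_series_right_const_eq0 {R : realType} (b : nat -> R) (K tau d : R) :
  0 < tau -> 0 < d -> (forall k, `|b k| * tau ^+ k <= K) ->
  (forall t, 0 < t -> t < d -> series (fun k => b k * t ^+ k) @ \oo --> (0 : R)) ->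
  b 0%N = 0.
Proof.
move=> tau0 d0 HK Hb.
have K0 : 0 <= K by apply: le_trans (HK 0%N); rewrite mulr_ge0 ?exprn_ge0// ltW.
(* For [t < tau / 2] the shifted terms are at most [(K / tau) 2 ^ (-k)], and [L] is the sum of these
   bounds. *)
pose L := K / tau * (1 - 2^-1)^-1.
have L0 : 0 <= L by rewrite /L mulr_ge0 ?divr_ge0 ?(ltW tau0)// invr_ge0; lra.
have H : forall t, 0 < t -> t < d -> t < tau / 2 -> `|b 0%N| <= L * t.
  move=> t tp td tt; rewrite -ler_pdivrMr//.
  rewrite -[X in _ / X](ger0_norm (ltW tp)) -normf_div -normrN.
  apply: (cvgn_norm_le (power_series_shift tp (Hb t tp td))) => n.
  apply: series_geometric_le; rewrite ?divr_ge0 ?(ltW tau0) ?invr_ge0//; first by lra.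
  move=> k; rewrite normrM normrX (ger0_norm (ltW tp)).
  apply: (@le_trans _ _ (`|b k.+1| * (tau / 2) ^+ k)).
    by rewrite ler_wpM2l// lerXn2r ?nnegrE ?ltW//; lra.
  rewrite exprMn mulrA ler_wpM2r ?exprn_ge0 ?invr_ge0//.
  by rewrite ler_pdivlMr// -mulrA -exprSr.
apply/eqP; rewrite -normr_eq0; apply/eqP/le_anti; rewrite normr_ge0 andbT.
apply/ler_addgt0Pl => e e0; rewrite addr0.
pose t := Num.min (Num.min (d / 2) (tau / 4)) (e / (L + 1)).
have L1 : 0 < L + 1 by lra.
have tp : 0 < t by rewrite /t !lt_min !divr_gt0.
have : t <= t by []. 
rewrite {2}/t !le_min => /andP[/andP[h1 h2] h3].
apply: le_trans (H t tp _ _) _; [lra|lra|].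
by rewrite ler_pdivlMr// in h3; nra.
Qed.

Lemma power_series_right_eq0 {R : realType} (b : nat -> R) (K tau d : R) :
  0 < tau -> 0 < d -> (forall k, `|b k| * tau ^+ k <= K) ->
  (forall t, 0 < t -> t < d -> series (fun k => b k * t ^+ k) @ \oo --> (0 : R)) ->
  forall k, b k = 0.
Proof.
move=> tau0 d0 HK Hb k; elim: k b K HK Hb => [|k IH] b K HK Hb.
  exact: power_series_right_const_eq0 tau0 d0 HK Hb.
apply: (IH (fun k => b k.+1) (K / tau)) => [j|t tp td].
  by rewrite ler_pdivlMr// -mulrA -exprSr.
have := power_series_shift tp (Hb t tp td).
by rewrite (power_series_right_const_eq0 tau0 d0 HK Hb) mul0r oppr0.
Qed.

Lemma hom_part_scale {R : realType} (a : nat -> nat -> R) k t x y :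
  hom_part a k (t * x) (t * y) = hom_part a k x y * t ^+ k.
Proof.
rewrite /hom_part mulr_suml; apply: eq_bigr => -[i ik] _ /=.
rewrite !exprMn; have -> : t ^+ k = t ^+ i * t ^+ (k - i).
  by rewrite -exprD subnKC// -ltnS.
by ring.
Qed.

(** By homogeneity, [f] along the ray is a power series in [t] whose coefficients are the values of
    the homogeneous parts at [e]. *)
Lemma expands_ray_eq0 {R : realType} (f : R * R -> R) p rho a (e : R * R) (h : R) :
  expands f p rho a -> `|e.1| <= 1 -> `|e.2| <= 1 -> 0 < h ->
  (forall t, 0 < t -> t < h -> f (p.1 + t * e.1, p.2 + t * e.2) = 0) ->
  forall k, hom_part a k e.1 e.2 = 0.
Proof.
move=> exf e1 e2 h0 H; have [r0 [M HM] _] := exf.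
have M0 : 0 <= M.
  by apply: le_trans (HM 0 0)%N; rewrite mulr_ge0 ?exprn_ge0// ltW.
(* Halving [rho] yields a factor [2 ^ (-k)] that absorbs the number [k + 1] of monomials. *)
apply: (@power_series_right_eq0 _ _ (M * (1 - 2^-1)^-1) (rho / 2) (Num.min h rho)).
- by lra.
- by rewrite lt_min h0.
- move=> k; apply: (@le_trans _ _ (k.+1%:R * (M * (1 / rho) ^+ k) * (rho / 2) ^+ k)).
    rewrite ler_wpM2r ?exprn_ge0//; first by lra.
    exact: (hom_part_le k r0 HM).
  have -> : k.+1%:R * (M * (1 / rho) ^+ k) * (rho / 2) ^+ k
      = M * (k.+1%:R * 2^-1 ^+ k).
    rewrite -mulrA -[M * _ * _]mulrA -exprMn mulrCA; congr (_ * (_ * _ ^+ _)).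
    by field; lra.
  by rewrite ler_wpM2l// natr_exp_bounded//; lra.
move=> t tp; rewrite lt_min => /andP[th tr].
have te c : `|c| <= 1 -> `|t * c| < rho.
  move=> c1; rewrite normrM (ger0_norm (ltW tp)); apply: le_lt_trans tr.
  by rewrite ler_piMr// ltW.
have := @expands_cvg _ _ _ _ _ (p.1 + t * e.1, p.2 + t * e.2) exf.
rewrite /= H// [p.1 + _]addrC [p.2 + _]addrC !addrK => /(_ (te _ e1) (te _ e2)).
rewrite (_ : (fun k => hom_part a k (t * e.1) (t * e.2))
  = (fun k => hom_part a k e.1 e.2 * t ^+ k))//.
by apply/funext => k; rewrite hom_part_scale.
Qed.

(** * Harmonic homogeneous polynomials *)

(** Subtracting the largest multiple of [pi] leaves a zero of the sine in [[0, pi)], where only 0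
    qualifies. *)
Lemma sin_eq0_natmul_pi {R : realType} (x : R) :
  0 <= x -> sin x = 0 -> exists n : nat, x = n%:R * pi.
Proof.
move=> x0 sx; have p0 : 0 < pi :> R := pi_gt0 R.
have xp : 0 <= x / pi by rewrite divr_ge0// ltW.
set n := Num.truncn (x / pi); exists n.
have /andP[] := truncn_itv xp; rewrite -/n ler_pdivlMr// ltr_pdivrMr// => h1 h2.
have sin_shift : forall (k : nat) (y : R), sin (y + k%:R * pi) = 0 -> sin y = 0.
  elim=> [|k IH] y; first by rewrite mul0r addr0.
  rewrite -natr1 mulrDl mul1r addrA sinDpi => /eqP.
  by rewrite oppr_eq0 => /eqP /IH.
have sy : sin (x - n%:R * pi) = 0 by apply: (sin_shift n); rewrite subrK.
have [y0|y0] := eqVneq (x - n%:R * pi) 0; first by apply/eqP; rewrite -subr_eq0 y0.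
have : 0 < sin (x - n%:R * pi).
  apply: sin_gt0_pi; rewrite lt_def y0 subr_ge0 h1/=.
  by rewrite -natr1 mulrDl mul1r in h2; lra.
by rewrite sy ltxx.
Qed.

Lemma sin_irrational_pi_neq0 {R : realType} (alpha : R) (n : nat) :
  0 <= alpha -> ~ (exists q : rat, alpha = ratr q) ->
  sin (n.+1%:R * (alpha * pi)) != 0.
Proof.
move=> a0 irr; apply/eqP => s0; apply: irr.
have p0 : 0 < pi :> R := pi_gt0 R.
have [|m mE] := sin_eq0_natmul_pi _ s0; first by rewrite !mulr_ge0// ltW.
exists (m%:R / n.+1%:R); rewrite fmorph_div !rmorph_nat.
have pn : pi != 0 :> R by rewrite gt_eqF.
by move: mE; rewrite mulrA => /(mulIf pn) <-; rewrite mulrC mulKf ?pnatr_eq0.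
Qed.

Local Open Scope complex_scope.

Lemma complex_de_moivre {R : realType} (x : R) (n : nat) :
  (cos x +i* sin x) ^+ n = cos (n%:R * x) +i* sin (n%:R * x).
Proof.
elim: n => [|n IH]; first by rewrite mul0r cos0 sin0.
rewrite exprS IH -natr1 mulrDl mul1r cosD sinD; simpc.
by congr (_ +i* _); ring.
Qed.

(* The gradient of a homogeneous harmonic polynomial of degree [n + 1]: the
   Cauchy-Riemann equations make [p - i q] a multiple of [(x + i y) ^ n]. *)
Lemma cauchy_riemann_binomial {R : realType} (p q : nat -> nat -> R) (n : nat) :
  (forall i j, (i + j).+1 = n -> i.+1%:R * p i.+1 j + j.+1%:R * q i j.+1 = 0) ->
  (forall i j, (i + j).+1 = n -> j.+1%:R * p i j.+1 = i.+1%:R * q i.+1 j) ->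
  forall j, (j <= n)%N ->
  p (n - j)%N j +i* - q (n - j)%N j = 'i ^+ j * 'C(n, j)%:R * (p n 0%N +i* - q n 0%N).
Proof.
move=> CR1 CR2; elim=> [|j IH] jn.
  by rewrite subn0 expr0 bin0 !mul1r.
have nz : j.+1%:R != 0 :> R[i] by rewrite pnatr_eq0.
apply: (mulfI nz).
have := IH (ltnW jn); have := mul_bin_left n j.
have E : (n - j = (n - j.+1).+1)%N by rewrite subnSK.
move: (CR1 (n - j.+1)%N j) (CR2 (n - j.+1)%N j).
rewrite -E -addnS subnK// => /(_ erefl) c1 /(_ erefl) c2 binE IHj.
(* The identity [(j + 1) C(n, j + 1) = (n - j) C(n, j)] reduces the right side to the case [j]; the
   two Cauchy-Riemann relations then match real and imaginary parts. *)
have -> : j.+1%:R * ('i ^+ j.+1 * 'C(n, j.+1)%:R * (p n 0%N +i* - q n 0%N))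
  = 'i * ((n - j)%:R * ('i ^+ j * 'C(n, j)%:R * (p n 0%N +i* - q n 0%N))).
  rewrite exprS; have := congr1 (fun k : nat => k%:R : R[i]) binE.
  rewrite !natrM; move: (j.+1%:R : R[i]) => J e.
  transitivity ('i * 'i ^+ j * (J * 'C(n, j.+1)%:R) * (p n 0%N +i* - q n 0%N)).
    by ring.
  by rewrite e; ring.
rewrite -IHj -!(rmorph_nat (real_complex R)).
simpc; congr (_ +i* _); lra.
Qed.

Lemma hom_part_complexE {R : realType} (p q : nat -> nat -> R) (n : nat) (x y : R) :
  (forall i j, (i + j).+1 = n -> i.+1%:R * p i.+1 j + j.+1%:R * q i j.+1 = 0) ->
  (forall i j, (i + j).+1 = n -> j.+1%:R * p i j.+1 = i.+1%:R * q i.+1 j) ->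
  hom_part p n x y +i* - hom_part q n x y
    = (p n 0%N +i* - q n 0%N) * (x +i* y) ^+ n.
Proof.
move=> CR1 CR2.
have xyE : x +i* y = x%:C + 'i * y%:C by simpc.
rewrite xyE exprDn mulr_sumr.
have -> : hom_part p n x y +i* - hom_part q n x y
    = (hom_part p n x y)%:C - 'i * (hom_part q n x y)%:C by simpc.
(* Reversing the sums puts the powers in the order of the binomial theorem. *)
rewrite -(hom_part_swap p) -(hom_part_swap q) /hom_part !rmorph_sum mulr_sumr -sumrB.
apply: eq_bigr => -[j jn] _ /=; have {}jn : (j <= n)%N by rewrite -ltnS.
transitivity ((p (n - j)%N j +i* - q (n - j)%N j) * (x%:C ^+ (n - j) * y%:C ^+ j)).
  rewrite -!rmorphXn /=; simpc; congr (_ +i* _); ring.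
rewrite (cauchy_riemann_binomial CR1 CR2 jn) exprMn -mulr_natr.
ring.
Qed.

(** Here [(p, q)] is the gradient and [p - i q = w (x + i y) ^ n]. Each ray condition says that
    [w e ^ (n + 1)] is real. *)
Lemma harmonic_gradient_eq0 {R : realType} (p q : nat -> nat -> R) (n : nat)
    (em ep : R * R) (theta : R) :
  (forall i j, (i + j).+1 = n -> i.+1%:R * p i.+1 j + j.+1%:R * q i j.+1 = 0) ->
  (forall i j, (i + j).+1 = n -> j.+1%:R * p i j.+1 = i.+1%:R * q i.+1 j) ->
  em.1 ^+ 2 + em.2 ^+ 2 = 1 ->
  ep = (cos theta * em.1 - sin theta * em.2, sin theta * em.1 + cos theta * em.2) ->
  sin (n.+1%:R * theta) != 0 ->
  em.1 * hom_part q n em.1 em.2 = em.2 * hom_part p n em.1 em.2 ->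
  ep.1 * hom_part q n ep.1 ep.2 = ep.2 * hom_part p n ep.1 ep.2 ->
  forall i j, (i + j)%N = n -> p i j = 0 /\ q i j = 0.
Proof.
move=> CR1 CR2 em1 epE sn0 Hm Hp.
set w := p n 0%N +i* - q n 0%N.
have Im_ray (e : R * R) : e.1 * hom_part q n e.1 e.2 = e.2 * hom_part p n e.1 e.2 ->
    complex.Im (w * (e.1 +i* e.2) ^+ n.+1) = 0.
  move=> H; rewrite exprSr mulrA -(hom_part_complexE _ _ CR1 CR2); simpc => /=.
  lra.
have := Im_ray _ Hm; have := Im_ray _ Hp.
have -> : ep.1 +i* ep.2 = (em.1 +i* em.2) * (cos theta +i* sin theta).
  by rewrite epE /=; simpc; congr (_ +i* _); ring.
rewrite exprMn complex_de_moivre mulrA.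
(* Passing from [em] to [ep] multiplies this number by [exp (i (n + 1) theta)]. Reality on [em]
   gives [b = 0], and reality on [ep] then gives [a sin ((n + 1) theta) = 0]. *)
case vE : (w * (em.1 +i* em.2) ^+ n.+1) => [a b].
simpc => /= h b0; move: h; rewrite b0 mul0r addr0 => /eqP.
rewrite mulf_eq0 (negPf sn0) orbF => /eqP a0.
have w0 : w = 0.
  have em0 : (em.1 +i* em.2) ^+ n.+1 != 0.
    rewrite expf_neq0// eq_complex /=; apply/negP => /andP[/eqP h1 /eqP h2].
    by move: em1; rewrite h1 h2 expr0n/= addr0 => /eqP; rewrite eq_sym oner_eq0.
  by apply: (mulIf em0); rewrite vE a0 b0 mul0r.
move=> i j ijn; have jn : (j <= n)%N by rewrite -ijn leq_addl.
have := cauchy_riemann_binomial CR1 CR2 jn.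
rewrite -/w w0 mulr0 (_ : (n - j)%N = i); last by rewrite -ijn addnK.
by move=> [-> /eqP]; rewrite oppr_eq0 => /eqP.
Qed.

Local Close Scope complex_scope.

(** * Normal conditions and the recursion on Taylor coefficients *)

Lemma normal_ray {R : realType} (e nu : R * R) (P Q : R) :
  e.1 ^+ 2 + e.2 ^+ 2 = 1 -> nu.1 ^+ 2 + nu.2 ^+ 2 = 1 ->
  nu.1 * e.1 + nu.2 * e.2 = 0 -> nu.1 * P + nu.2 * Q = 0 -> e.1 * Q = e.2 * P.
Proof.
(* The normal is [c (- e.2, e.1)] with [c] the cross product of [e] and [nu], and [c] is nonzero
   since [nu] is a unit vector. *)
move=> e1 nu1 ort H; pose c := nu.2 * e.1 - nu.1 * e.2.
have n1 : nu.1 = - (c * e.2).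
  transitivity (nu.1 * (e.1 ^+ 2 + e.2 ^+ 2)); first by rewrite e1 mulr1.
  have -> : nu.1 * (e.1 ^+ 2 + e.2 ^+ 2)
    = - (c * e.2) + e.1 * (nu.1 * e.1 + nu.2 * e.2) by rewrite /c; ring.
  by rewrite ort mulr0 addr0.
have n2 : nu.2 = c * e.1.
  transitivity (nu.2 * (e.1 ^+ 2 + e.2 ^+ 2)); first by rewrite e1 mulr1.
  have -> : nu.2 * (e.1 ^+ 2 + e.2 ^+ 2)
    = c * e.1 + e.2 * (nu.1 * e.1 + nu.2 * e.2) by rewrite /c; ring.
  by rewrite ort mulr0 addr0.
have c0 : c != 0.
  apply/eqP => c0; move: nu1; rewrite n1 n2 c0 !mul0r oppr0 expr0n/= addr0 => /eqP.
  by rewrite eq_sym oner_eq0.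
apply/eqP; rewrite -subr_eq0; apply/eqP/(mulfI c0); rewrite mulr0 -{}H n1 n2.
by rewrite -/c; ring.
Qed.

Lemma hom_part_eq0 {R : realType} (a : nat -> nat -> R) k x y :
  (forall i j, (i + j)%N = k -> a i j = 0) -> hom_part a k x y = 0.
Proof.
move=> H; rewrite /hom_part big1// => -[i ik] _ /=.
by rewrite H ?mul0r// subnKC// -ltnS.
Qed.

Lemma unit_coords_le1 {R : realType} (e : R * R) :
  e.1 ^+ 2 + e.2 ^+ 2 = 1 -> `|e.1| <= 1 /\ `|e.2| <= 1.
Proof. by move=> e1; rewrite !ler_norml; split; nra. Qed.

Lemma expands_normal_deriv {R : realType} (f : R * R -> R) p rho a sigma nu :
  expands f p rho a -> 0 < sigma -> sigma < rho ->
  expands (normal_deriv nu f) p sigma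
    (fun i j => nu.1 * (i.+1%:R * a i.+1 j) + nu.2 * (j.+1%:R * a i j.+1)).
Proof.
move=> exf s0 sr.
exact: expands_lin (expands_pdx exf s0 sr) (expands_pdy exf s0 sr).
Qed.

(** The function [laplacian f + lambda f] vanishes near [p], so uniqueness kills the coefficients of
    its expansion. *)
Lemma helmholtz_coef {R : realType} (Omega : set (R * R)) (lambda : R)
    (f : R * R -> R) p rho a :
  open Omega -> Omega p -> expands f p rho a ->
  (forall q, Omega q -> - laplacian f q = lambda * f q) ->
  forall i j, i.+1%:R * (i.+2%:R * a i.+2 j) + j.+1%:R * (j.+2%:R * a i j.+2)
    = - (lambda * a i j).
Proof.
move=> oO Op exf H i j; have [r0 _ _] := exf.
have h1 : 0 < rho / 2 by lra. have h2 : rho / 2 < rho by lra.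
have h3 : 0 < rho / 4 by lra. have h4 : rho / 4 < rho / 2 by lra.
have exx := expands_pdx (expands_pdx exf h1 h2) h3 h4.
have eyy := expands_pdy (expands_pdy exf h1 h2) h3 h4.
have ex0 := expandsW exf h3 (ltW (lt_trans h4 h2)).
(* The zero multiple of [f] only fills the second slot of the linear combination. *)
have exL := expands_lin 1 1 (expands_lin 1 1 exx eyy) (expands_lin lambda 0 ex0 ex0).
have /nbhs_ballP[d /= d0 dO] := open_nbhs_nbhs (conj oO Op).
suff h : forall q : R * R, `|q.1 - p.1| < d -> `|q.2 - p.2| < d ->
    1 * (1 * pdx (pdx f) q + 1 * pdy (pdy f) q) + 1 * (lambda * f q + 0 * f q) = 0.
  by have := expands0_eq0 exL d0 h i j; lra.
move=> q q1 q2; have /H : Omega q.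
  by apply: dO; split; rewrite /ball/= distrC.
by rewrite /laplacian; lra.
Qed.

Lemma taylor_coef_step {R : realType} (lambda : R) (a : nat -> nat -> R)
    (em ep num nup : R * R) (theta : R) (n : nat) :
  (forall i j, i.+1%:R * (i.+2%:R * a i.+2 j) + j.+1%:R * (j.+2%:R * a i j.+2)
     = - (lambda * a i j)) ->
  em.1 ^+ 2 + em.2 ^+ 2 = 1 -> ep.1 ^+ 2 + ep.2 ^+ 2 = 1 ->
  ep = (cos theta * em.1 - sin theta * em.2, sin theta * em.1 + cos theta * em.2) ->
  sin (n.+1%:R * theta) != 0 ->
  nup.1 ^+ 2 + nup.2 ^+ 2 = 1 -> nup.1 * ep.1 + nup.2 * ep.2 = 0 ->
  num.1 ^+ 2 + num.2 ^+ 2 = 1 -> num.1 * em.1 + num.2 * em.2 = 0 ->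
  (forall i j, (i + j < n.+1)%N -> a i j = 0) ->
  hom_part (fun i j => nup.1 * (i.+1%:R * a i.+1 j) + nup.2 * (j.+1%:R * a i j.+1))
    n ep.1 ep.2 = 0 ->
  hom_part (fun i j => num.1 * (i.+1%:R * a i.+1 j) + num.2 * (j.+1%:R * a i j.+1))
    n em.1 em.2 = 0 ->
  forall i j, (i + j)%N = n.+1 -> a i j = 0.
Proof.
move=> lapE em1 ep1 epE sn0 nup1 nupo num1 numo IH.
rewrite !hom_part_lin => /(normal_ray ep1 nup1 nupo) Hp /(normal_ray em1 num1 numo) Hm.
have grad0 := harmonic_gradient_eq0 _ _ em1 epE sn0 Hm Hp.
have {}grad0 i j : (i + j)%N = n ->
    i.+1%:R * a i.+1 j = 0 /\ j.+1%:R * a i j.+1 = 0.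
  (* The first Cauchy-Riemann relation is the Helmholtz recursion, whose right side has degree
     [n - 1] and vanishes by hypothesis; the second is the symmetry of mixed derivatives. *)
  apply: grad0 => {}i {}j ijn.
    by rewrite lapE IH ?mulr0 ?oppr0// -ijn leqW.
  by ring.
(* As the degree is positive, each coefficient occurs in one of the two gradient components. *)
case=> [|i] [|j] // ijn.
- have [//|_ /eqP] := grad0 0%N j; first by case: ijn.
  by rewrite mulf_eq0 pnatr_eq0 => /eqP.
- have [|/eqP + _] := grad0 i 0%N; first by case: ijn.
  by rewrite mulf_eq0 pnatr_eq0 => /eqP.
- have [|/eqP + _] := grad0 i j.+1; first by case: ijn.
  by rewrite mulf_eq0 pnatr_eq0 => /eqP.
Qed.

Lemma Vani_eq0 {R : realType} (ur ui : R * R -> R) (x0 : R * R) :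
  (ur x0, ui x0) != (0, 0) -> Vani ur ui x0 = Some 0%N.
Proof.
move=> u0; have H0 : hom_term_nonzero ur ui x0 0.
  exists 0%N, 0%N; split=> //; apply/orP; move: u0.
  by rewrite -pair_eqE negb_and.
rewrite /Vani; case: pselect => [H|]; last by case; exists 0%N.
congr Some; case: ex_minnP => m _ /(_ 0%N); rewrite leqn0 => h.
by apply/eqP/h/asboolP.
Qed.

Lemma Vani_None {R : realType} (ur ui : R * R -> R) (x0 : R * R) :
  (forall i j, pderiv i j ur x0 = 0 /\ pderiv i j ui x0 = 0) ->
  Vani ur ui x0 = None.
Proof.
move=> H; rewrite /Vani; case: pselect => // h; exfalso.
by have [N [i [j [_]]]] := h; have [-> ->] := H i j; rewrite eqxx => -[].
Qed.

(** * Induction on the degree of the Taylor terms *)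

Unset Implicit Arguments.
Set Strict Implicit.

Theorem theorem4p3 (R : realType) (Omega : set (R * R)) (lambda : R)
    (ur ui : R * R -> R) (x0 : R * R) (h : R) (em ep : R * R) (alpha : R)
    (num nup : R * R) (C1 : R * R) :
  open Omega ->
  0 < lambda ->
  (* u = ur + i ui is real-analytic in Omega and u in L^2(Omega) *)
  real_analytic_on Omega ur -> real_analytic_on Omega ui ->
  L2_on Omega ur ui ->
  (* - Delta u = lambda u in Omega *)
  (forall p, Omega p -> - laplacian ur p = lambda * ur p) ->
  (forall p, Omega p -> - laplacian ui p = lambda * ui p) ->
  Omega x0 ->
  0 < h ->
  (* e^-, e^+ unit vectors, e^+ is e^- rotated by the angle alpha * pi *)
  em.1 ^+ 2 + em.2 ^+ 2 = 1 ->
  ep = (cos (alpha * pi) * em.1 - sin (alpha * pi) * em.2,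
        sin (alpha * pi) * em.1 + cos (alpha * pi) * em.2) ->
  0 < alpha < 2 ->
  ~ (exists q : rat, alpha = ratr q) ->
  segment x0 ep h `<=` Omega ->
  segment x0 em h `<=` Omega ->
  (* nup, num : unit normals to Gamma^+, Gamma^- *)
  nup.1 ^+ 2 + nup.2 ^+ 2 = 1 -> nup.1 * ep.1 + nup.2 * ep.2 = 0 ->
  num.1 ^+ 2 + num.2 ^+ 2 = 1 -> num.1 * em.1 + num.2 * em.2 = 0 ->
  (* Gamma^+ is a singular line: d_nu u = 0 on Gamma^+ *)
  (forall p, segment x0 ep h p ->
     normal_deriv nup ur p = 0 /\ normal_deriv nup ui p = 0) ->
  (* Gamma^- is a generalized singular line with constant parameter
     eta_1 = C1 = C1.1 + i C1.2 <> 0 : d_nu u + C1 u = 0 on Gamma^- *)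
  C1 != (0, 0) ->
  (forall p, segment x0 em h p ->
     normal_deriv num ur p + (C1.1 * ur p - C1.2 * ui p) = 0 /\
     normal_deriv num ui p + (C1.1 * ui p + C1.2 * ur p) = 0) ->
  ((ur x0, ui x0) != (0, 0) -> Vani ur ui x0 = Some 0%N) /\
  ((ur x0, ui x0) = (0, 0) -> Vani ur ui x0 = None).
Proof.
move=> oO _ anr ani _ Hr Hi Ox0 h0 em1 epE /andP[al0 _] irr _ _ nup1 nupo num1 numo
  Hp _ Hm.
split=> [|u0]; first exact: Vani_eq0.
have [r1 [a exr']] := real_analytic_expands (anr _ Ox0).
have [r2 [b exi']] := real_analytic_expands (ani _ Ox0).
have [[r10 _ _] [r20 _ _]] := (exr', exi').
(* A common radius is needed because the condition on [Gamma^-] mixes [ur] and [ui]. *)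
have r0 : 0 < Num.min r1 r2 by rewrite lt_min r10.
have [le1 le2] : Num.min r1 r2 <= r1 /\ Num.min r1 r2 <= r2.
  by rewrite !ge_min !lexx orbT.
have exr := expandsW exr' r0 le1; have exi := expandsW exi' r0 le2.
move: (Num.min r1 r2) r0 exr exi {le1 le2} => rho r0 exr exi.
have s0 : 0 < rho / 2 by lra. have sr : rho / 2 < rho by lra.
have exr2 := expandsW exr s0 (ltW sr).
have exi2 := expandsW exi s0 (ltW sr).
have ep1 : ep.1 ^+ 2 + ep.2 ^+ 2 = 1.
  rewrite epE /=; rewrite -[RHS]em1 -[RHS]mul1r -(cos2Dsin2 (alpha * pi)); ring.
have [em11 em12] := unit_coords_le1 em1; have [ep11 ep12] := unit_coords_le1 ep1.
have seg e t : 0 < t -> t < h -> segment x0 e h (x0.1 + t * e.1, x0.2 + t * e.2).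
  by move=> tp th; exists t => //=; rewrite in_itv/= !ltW.
have rayr := expands_ray_eq0 (expands_normal_deriv nup exr s0 sr) ep11 ep12 h0
  (fun t tp th => proj1 (Hp _ (seg ep t tp th))).
have rayi := expands_ray_eq0 (expands_normal_deriv nup exi s0 sr) ep11 ep12 h0
  (fun t tp th => proj2 (Hp _ (seg ep t tp th))).
(* Real part of [d_nu u + C1 u], expanded on the half radius where the normal derivative is
   available. *)
have raymr k : hom_part (fun i j =>
    1 * (num.1 * (i.+1%:R * a i.+1 j) + num.2 * (j.+1%:R * a i j.+1))
    + 1 * (C1.1 * a i j + - C1.2 * b i j)) k em.1 em.2 = 0.
  have ex := expands_lin 1 1 (expands_normal_deriv num exr s0 sr)
    (expands_lin C1.1 (- C1.2) exr2 exi2).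
  apply: (expands_ray_eq0 ex em11 em12 h0).
  by move=> t tp th /=; have [e1 _] := Hm _ (seg em t tp th); lra.
have raymi k : hom_part (fun i j =>
    1 * (num.1 * (i.+1%:R * b i.+1 j) + num.2 * (j.+1%:R * b i j.+1))
    + 1 * (C1.1 * b i j + C1.2 * a i j)) k em.1 em.2 = 0.
  have ex := expands_lin 1 1 (expands_normal_deriv num exi s0 sr)
    (expands_lin C1.1 C1.2 exi2 exr2).
  apply: (expands_ray_eq0 ex em11 em12 h0).
  by move=> t tp th /=; have [_ e2] := Hm _ (seg em t tp th); lra.
have lapr := helmholtz_coef oO Ox0 exr Hr.
have lapi := helmholtz_coef oO Ox0 exi Hi.
(* Both parts go through one strong induction, since complex [C1] couples them. *)
have ab0 N : forall i j, (i + j)%N = N -> a i j = 0 /\ b i j = 0.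
  elim/ltn_ind: N => -[_ [|//] [|//] _|n IH i j ijn].
    by rewrite -(expands_center exr) -(expands_center exi); case: u0.
  have IHa k l : (k + l < n.+1)%N -> a k l = 0 by move=> kl; case: (IH _ kl k l).
  have IHb k l : (k + l < n.+1)%N -> b k l = 0 by move=> kl; case: (IH _ kl k l).
  (* In degree [n] the term [C1 u] involves only coefficients of degree [n], already zero, while
     [d_nu u] involves those of degree [n + 1]. *)
  have a0 : hom_part a n em.1 em.2 = 0.
    by apply: hom_part_eq0 => k l kl; rewrite IHa// kl.
  have b0 : hom_part b n em.1 em.2 = 0.
    by apply: hom_part_eq0 => k l kl; rewrite IHb// kl.
  have sn0 := sin_irrational_pi_neq0 n (ltW al0) irr.
  have := raymr n; have := raymi n.
  rewrite !(hom_part_lin _ _ 1) !(hom_part_lin _ _ C1.1) a0 b0.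
  rewrite !mulr0 !addr0 !mulr0 !addr0 !mul1r => mi mr.
  split.
  - exact: taylor_coef_step lapr em1 ep1 epE sn0 nup1 nupo num1 numo
      IHa (rayr n) mr i j ijn.
  - exact: taylor_coef_step lapi em1 ep1 epE sn0 nup1 nupo num1 numo
      IHb (rayi n) mi i j ijn.
apply: Vani_None => i j; split.
- by apply: pderiv_eq0 exr _ => k l; case: (ab0 _ k l erefl).
- by apply: pderiv_eq0 exi _ => k l; case: (ab0 _ k l erefl).
Qed.
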